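(* Let $F$ be a formally real field and let $K$ be a totally positive field extension of $F$. Let $(A,\sigma)$ be a totally decomposable central simple algebra with an orthogonal involution over $F$. If $(A,\sigma)$ is weakly isotropic over $K$, i.e. $(A\otimes_F K,\sigma\otimes\mathrm{id}_K)$ is weakly isotropic, then $(A,\sigma)$ is weakly hyperbolic over $F$.
   Context: A field $F$ is formally real if $-1$ is not a sum of squares in $F$. A semiordering of a field $F$ is a subset $S\subset F$ with $1\in S$, $F^2S\subset S$, $S+S\subset S$, $S\cup -S=F$ and $S\cap -S=\{0\}$. A field extension $K/F$ is totally positive if every semiordering $S$ of $F$ extends to a semiordering $S'$ of $K$ (i.e. $S'\cap F=S$). Let $(A,\sigma)$ be a central simple algebra with orthogonal involution over a field $F$. It is totally decomposable if $(A,\sigma)\simeq (Q_1,\sigma_1)\otimes_F\cdots\otimes_F(Q_r,\sigma_r)$ for some quaternion $F$-algebras $Q_i$ with involutions $\sigma_i$ of the first kind. It is weakly isotropic if there exist nonzero $x_1,\dots,x_n\in A$ (for some $n\ge 1$) with $\sum_{i=1}^n\sigma(x_i)x_i=0$. It is hyperbolic if there is $e\in A$ with $e^2=e$ and $\sigma(e)=1-e$. It is weakly hyperbolic if there is $n\in\mathbb{N}$, $n\ge 1$, such that $(M_n(F),t)\otimes_F(A,\sigma)$ is hyperbolic, where $t$ is the transpose involution. *)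

(* Defs.v *)
From HB Require Import structures.
From mathcomp Require Import all_boot all_order all_algebra all_field.

Set Implicit Arguments.
Unset Strict Implicit.
Unset Printing Implicit Defensive.

Import GRing.Theory.
Local Open Scope ring_scope.

Definition formally_real (F : fieldType) : Prop :=
  ~ exists s : seq F, -1 = \sum_(x <- s) x ^+ 2.

Definition semiordering (F : fieldType) (S : F -> Prop) : Prop :=
  [/\ S 1,
      forall a x, S x -> S (a ^+ 2 * x),
      forall x y, S x -> S y -> S (x + y),
      forall x, S x \/ S (- x)
    & forall x, S x /\ S (- x) <-> x = 0].

(* A field extension K/F is given by its embedding iota : F -> K; it need not *)
(* be finite, or even algebraic.                                              *)
Definition totally_positive (F K : fieldType) (iota : {rmorphism F -> K}) :=
  forall S : F -> Prop, semiordering S ->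
    exists2 S' : K -> Prop, semiordering S' & forall x, S' (iota x) <-> S x.

(* The tensor product A (x)_F B of an arbitrary F-module B with a finite      *)
(* dimensional A, in coordinates: if (e_i) is the chosen basis of A, then     *)
(* x : tensor A B stands for \sum_i e_i (x) x i. Independence of the choice   *)
(* of basis is the universal property tensor_universal below.                 *)
Definition tensor (F : fieldType) (A : vectType F) (B : lmodType F) : Type :=
  {ffun 'I_(\dim {:A}) -> B}.

Section TensorModule.
Variables (F : fieldType) (A : vectType F) (B : lmodType F).

HB.instance Definition _ :=
  GRing.Lmodule.copy (tensor A B) {ffun 'I_(\dim {:A}) -> B}.

Definition tens (a : A) (b : B) : tensor A B :=
  [ffun i => coord (vbasis {:A}) i a *: b].

Lemma tensDl a a' b : tens (a + a') b = tens a b + tens a' b.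
Proof. by apply/ffunP=> i; rewrite !ffunE linearD scalerDl. Qed.

Lemma tensDr a b b' : tens a (b + b') = tens a b + tens a b'.
Proof. by apply/ffunP=> i; rewrite !ffunE scalerDr. Qed.

Lemma tensZl c a b : tens (c *: a) b = c *: tens a b.
Proof. by apply/ffunP=> i; rewrite !ffunE linearZ scalerA. Qed.

Lemma tensZr c a b : tens a (c *: b) = c *: tens a b.
Proof. by apply/ffunP=> i; rewrite !ffunE !scalerA mulrC. Qed.

Lemma tens0l b : tens 0 b = 0.
Proof. by rewrite -(scale0r 0) tensZl scale0r. Qed.

Lemma tens0r a : tens a 0 = 0.
Proof. by rewrite -(scale0r 0) tensZr scale0r. Qed.

Lemma tens_suml (I : Type) (r : seq I) (P : pred I) (G : I -> A) b :
  tens (\sum_(i <- r | P i) G i) b = \sum_(i <- r | P i) tens (G i) b.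
Proof.
exact: (big_morph (tens^~ b) (fun a a' => tensDl a a' b) (tens0l b)).
Qed.

Lemma tens_sumr (I : Type) (r : seq I) (P : pred I) a (G : I -> B) :
  tens a (\sum_(i <- r | P i) G i) = \sum_(i <- r | P i) tens a (G i).
Proof. exact: (big_morph (tens a) (tensDr a) (tens0r a)). Qed.

Lemma tensorE (x : tensor A B) :
  x = \sum_(i < \dim {:A}) tens (vbasis {:A})`_i (x i).
Proof.
apply/ffunP=> j; rewrite sum_ffunE (bigD1 j) //= ffunE.
rewrite coord_free ?(basis_free (vbasisP _)) // eqxx scale1r.
rewrite big1 ?addr0 // => i ne_ij; rewrite ffunE.
rewrite coord_free ?(basis_free (vbasisP _)) //.
by rewrite (negPf ne_ij) scale0r.
Qed.

Lemma tensor_ind (P : tensor A B -> Prop) :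
    (forall a b, P (tens a b)) -> (forall x y, P x -> P y -> P (x + y)) ->
  forall x, P x.
Proof.
move=> Pt PD x; rewrite [x]tensorE.
by apply: big_ind => //; rewrite -(tens0l 0).
Qed.

Lemma tensor_universal (C : lmodType F) (f : A -> B -> C) :
    (forall b, linear (f^~ b)) -> (forall a, linear (f a)) ->
  exists g : tensor A B -> C,
    [/\ linear g, forall a b, g (tens a b) = f a b
      & forall h : tensor A B -> C,
          linear h -> (forall a b, h (tens a b) = f a b) -> h =1 g].
Proof.
move=> fl fr.
have fDr a : {morph f a : b b' / b + b'}.
  by move=> b b'; have:= fr a 1 b b'; rewrite !scale1r.
have fDl b : {morph f^~ b : a a' / a + a'}.
  by move=> a a'; have:= fl b 1 a a'; rewrite !scale1r.
have f0r a : f a 0 = 0 by apply: (addrI (f a 0)); rewrite -fDr !addr0.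
have f0l b : f 0 b = 0 by apply: (addrI (f 0 b)); rewrite -(fDl b) !addr0.
have fZr a c b : f a (c *: b) = c *: f a b.
  by have:= fr a c b 0; rewrite f0r !addr0.
have fZl b c a : f (c *: a) b = c *: f a b.
  by have:= fl b c a 0; rewrite f0l !addr0.
pose g (x : tensor A B) := \sum_(i < \dim {:A}) f (vbasis {:A})`_i (x i).
have g_lin : linear g.
  move=> c x y; rewrite /g scaler_sumr -big_split; apply: eq_bigr => i _ /=.
  by rewrite !ffunE fr.
have g_tens a b : g (tens a b) = f a b.
  rewrite {2}(coord_vbasis (memvf a)) (big_morph _ (fDl b) (f0l b)).
  by apply: eq_bigr => i _; rewrite ffunE fZr fZl.
exists g; split=> // h h_lin h_tens.
apply: tensor_ind => [a b|x y hx hy]; first by rewrite h_tens g_tens.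
have:= h_lin 1 x y; rewrite !scale1r => ->; rewrite hx hy.
by have:= g_lin 1 x y; rewrite !scale1r => ->.
Qed.

End TensorModule.

Section TensorMap.
Variables (F : fieldType) (A A' : vectType F) (B B' : lmodType F).

Definition tensor_map (s : A -> A') (t : B -> B') (x : tensor A B) :
  tensor A' B' :=
  \sum_(i < \dim {:A}) tens (s (vbasis {:A})`_i) (t (x i)).

Variables (s : {linear A -> A'}) (t : {linear B -> B'}).

Lemma tensor_map_is_linear : linear (tensor_map s t).
Proof.
move=> c x y; rewrite /tensor_map scaler_sumr -big_split; apply: eq_bigr => i _.
by rewrite !ffunE linearP tensDr tensZr.
Qed.

Lemma tensor_mapE a b : tensor_map s t (tens a b) = tens (s a) (t b).
Proof.
rewrite {2}(coord_vbasis (memvf a)) linear_sum tens_suml.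
by apply: eq_bigr => i _; rewrite ffunE !linearZ tensZr tensZl.
Qed.

End TensorMap.

Section TensorAlgebra.
Variables (F : fieldType) (A : falgType F) (B : algType F).
Local Notation AB := (tensor A B).
Implicit Types x y z : AB.

Definition tensor_one : AB := tens 1 1.

Definition tensor_mul x y : AB :=
  \sum_(i < \dim {:A}) \sum_(j < \dim {:A})
    tens ((vbasis {:A})`_i * (vbasis {:A})`_j) (x i * y j).

Lemma tensor_mulDl : left_distributive tensor_mul +%R.
Proof.
move=> x y z; rewrite /tensor_mul -big_split; apply: eq_bigr => i _ /=.
rewrite -big_split; apply: eq_bigr => j _ /=.
by rewrite ffunE mulrDl tensDr.
Qed.

Lemma tensor_mulDr : right_distributive tensor_mul +%R.
Proof.
move=> x y z; rewrite /tensor_mul -big_split; apply: eq_bigr => i _ /=.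
rewrite -big_split; apply: eq_bigr => j _ /=.
by rewrite ffunE mulrDr tensDr.
Qed.

Lemma tensor_mul_tens a b a' b' :
  tensor_mul (tens a b) (tens a' b') = tens (a * a') (b * b').
Proof.
rewrite {2}(coord_vbasis (memvf a)) {2}(coord_vbasis (memvf a')).
rewrite mulr_suml tens_suml; apply: eq_bigr => i _.
rewrite mulr_sumr tens_suml; apply: eq_bigr => j _.
by rewrite !ffunE -!scalerAl -!scalerAr !tensZl !tensZr.
Qed.

Lemma tensor_mulA : associative tensor_mul.
Proof.
elim/tensor_ind=> [a b|x1 x2 IH1 IH2] y z; last first.
  by rewrite !tensor_mulDl IH1 IH2.
elim/tensor_ind: y => [a' b'|y1 y2 IH1 IH2]; last first.
  by rewrite tensor_mulDl !tensor_mulDr tensor_mulDl IH1 IH2.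
elim/tensor_ind: z => [c d|z1 z2 IH1 IH2]; last first.
  by rewrite !tensor_mulDr IH1 IH2.
by rewrite !tensor_mul_tens !mulrA.
Qed.

Lemma tensor_mul1 : left_id tensor_one tensor_mul.
Proof.
elim/tensor_ind=> [a b|x1 x2 IH1 IH2]; last by rewrite tensor_mulDr IH1 IH2.
by rewrite tensor_mul_tens !mul1r.
Qed.

Lemma tensor_1mul : right_id tensor_one tensor_mul.
Proof.
elim/tensor_ind=> [a b|x1 x2 IH1 IH2]; last by rewrite tensor_mulDl IH1 IH2.
by rewrite tensor_mul_tens !mulr1.
Qed.

Lemma tensor_one_neq0 : tensor_one != 0.
Proof.
apply/eqP=> /ffunP tens0; have /eqP[] := oner_neq0 A.
rewrite (coord_vbasis (memvf (1 : A))) big1 // => i _.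
by have/eqP := tens0 i; rewrite !ffunE scaler_eq0 oner_eq0 orbF => /eqP->;
   rewrite scale0r.
Qed.

HB.instance Definition _ := GRing.Zmodule_isNzRing.Build AB
  tensor_mulA tensor_mul1 tensor_1mul tensor_mulDl tensor_mulDr tensor_one_neq0.

Lemma tensM a b a' b' : tens a b * tens a' b' = tens (a * a') (b * b') :> AB.
Proof. exact: tensor_mul_tens. Qed.

Lemma tensor_scalerAl c x y : c *: (x * y) = (c *: x) * y.
Proof.
elim/tensor_ind: x => [a b|x1 x2 IH1 IH2]; last first.
  by rewrite mulrDl !scalerDr mulrDl IH1 IH2.
elim/tensor_ind: y => [a' b'|y1 y2 IH1 IH2]; last first.
  by rewrite !mulrDr scalerDr IH1 IH2.
by rewrite tensM -tensZl -!tensZl tensM -scalerAl.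
Qed.

HB.instance Definition _ := GRing.Lmodule_isLalgebra.Build F AB tensor_scalerAl.

Lemma tensor_scalerAr c x y : c *: (x * y) = x * (c *: y).
Proof.
elim/tensor_ind: x => [a b|x1 x2 IH1 IH2]; last first.
  by rewrite !mulrDl scalerDr IH1 IH2.
elim/tensor_ind: y => [a' b'|y1 y2 IH1 IH2]; last first.
  by rewrite !(mulrDr, scalerDr) IH1 IH2.
by rewrite tensM -!tensZl tensM -scalerAr.
Qed.

HB.instance Definition _ :=
  GRing.Lalgebra_isAlgebra.Build F AB tensor_scalerAr.

End TensorAlgebra.

HB.instance Definition _ (F : fieldType) (A : vectType F) (B : vectType F) :=
  Vector.copy (tensor A B) {ffun 'I_(\dim {:A}) -> B}.
HB.instance Definition _ (F : fieldType) (A B : falgType F) :=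
  Algebra_isFalgebra.Build F (tensor A B).

(* The target of iota : F -> K, seen as an F-algebra. *)
Definition ext_alg (F K : fieldType) (iota : {rmorphism F -> K}) : Type := K.

Section ExtAlg.
Variables (F K : fieldType) (iota : {rmorphism F -> K}).

HB.instance Definition _ := GRing.Field.copy (ext_alg iota) K.

Definition ext_scale (a : F) (x : ext_alg iota) : ext_alg iota := iota a * x.

Lemma ext_scaleA a b x : ext_scale a (ext_scale b x) = ext_scale (a * b) x.
Proof. by rewrite /ext_scale rmorphM mulrA. Qed.

Lemma ext_scale1 : left_id 1 ext_scale.
Proof. by move=> x; rewrite /ext_scale rmorph1 mul1r. Qed.

Lemma ext_scaleDr : right_distributive ext_scale +%R.
Proof. by move=> a x y; rewrite /ext_scale mulrDr. Qed.

Lemma ext_scaleDl x : {morph ext_scale^~ x : a b / a + b}.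
Proof. by move=> a b; rewrite /ext_scale rmorphD mulrDl. Qed.

HB.instance Definition _ := GRing.Zmodule_isLmodule.Build F (ext_alg iota)
  ext_scaleA ext_scale1 ext_scaleDr ext_scaleDl.

Lemma ext_scalerAl (a : F) (x y : ext_alg iota) : a *: (x * y) = (a *: x) * y.
Proof. exact: mulrA. Qed.

HB.instance Definition _ :=
  GRing.Lmodule_isLalgebra.Build F (ext_alg iota) ext_scalerAl.

Lemma ext_scalerAr (a : F) (x y : ext_alg iota) : a *: (x * y) = x * (a *: y).
Proof. exact: mulrCA. Qed.

HB.instance Definition _ :=
  GRing.Lalgebra_isAlgebra.Build F (ext_alg iota) ext_scalerAr.

End ExtAlg.

(* Involutions of the first kind: the base field is fixed. The identity is    *)
(* allowed (on a commutative algebra).                                        *)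
Definition is_involution (F : fieldType) (A : algType F) (s : A -> A) : Prop :=
  [/\ linear s, {morph s : x y / x * y >-> y * x} & involutive s].

Record invAlg (F : fieldType) := InvAlg {
  invAlg_carrier :> falgType F;
  invol : invAlg_carrier -> invAlg_carrier;
  involP : is_involution invol
}.
Arguments InvAlg {F} _ _ _.
Arguments invol {F _} _.

Lemma tensor_invP (F : fieldType) (A B : invAlg F) :
  is_involution (tensor_map (@invol F A) (@invol F B)).
Proof.
have [[sl sM sK] [tl tM tK]] := (involP A, involP B).
pose sL := GRing.isLinear.Build F A A *:%R (@invol F A) sl.
pose tL := GRing.isLinear.Build F B B *:%R (@invol F B) tl.
pose s : {linear A -> A} := HB.pack (@invol F A) sL.
pose t : {linear B -> B} := HB.pack (@invol F B) tL.
have stl : linear (tensor_map s t) := tensor_map_is_linear s t.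
have stD x y : tensor_map s t (x + y) = tensor_map s t x + tensor_map s t y.
  by have:= stl 1 x y; rewrite !scale1r.
split=> // [x y|].
  change (tensor_map s t (x * y) = tensor_map s t y * tensor_map s t x).
  elim/tensor_ind: x => [a b|x1 x2 IH1 IH2]; last first.
    by rewrite mulrDl !stD mulrDr IH1 IH2.
  elim/tensor_ind: y => [a' b'|y1 y2 IH1 IH2]; last first.
    by rewrite mulrDr !stD mulrDl IH1 IH2.
  by rewrite tensM !tensor_mapE tensM /= sM tM.
change (involutive (tensor_map s t)).
elim/tensor_ind=> [a b|x1 x2 IH1 IH2]; last by rewrite !stD IH1 IH2.
by rewrite !tensor_mapE /= sK tK.
Qed.

Definition inv_tensor (F : fieldType) (A B : invAlg F) : invAlg F :=
  InvAlg (tensor A B) _ (tensor_invP A B).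

Lemma trmx_invP (F : fieldType) (n : nat) :
  is_involution (fun X : 'M[F]_n.+1 => X^T).
Proof.
split=> [c X Y|X Y|X]; [by rewrite linearP | exact: trmx_mul | exact: trmxK].
Qed.

(* (M_n.+1(F), t) *)
Definition inv_matrix (F : fieldType) (n : nat) : invAlg F :=
  InvAlg 'M[F]_n.+1 _ (trmx_invP F n).

Definition inv_isomorphic (F : fieldType) (A B : invAlg F) : Prop :=
  exists2 f : {lrmorphism A -> B}, bijective f & {morph f : x / invol x}.

Definition central_simple (F : fieldType) (A : falgType F) : Prop :=
  'Z({:A})%VS = 1%VS /\
  forall U : {vspace A}, ({:A} * U <= U)%VS -> (U * {:A} <= U)%VS ->
    U = 0%VS \/ U = {:A}%VS.

Definition quaternion (F : fieldType) (Q : falgType F) : Prop :=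
  central_simple Q /\ \dim {:Q} = 4.

(* Over some splitting field L of A, with f : A (x)_F L = M_n(L), the scalar  *)
(* extension of the involution is adjoint to the nondegenerate symmetric      *)
(* bilinear form with Gram matrix g. This is the usual notion if F has        *)
(* characteristic different from 2; otherwise g must also be non-alternating. *)
Definition orthogonal_inv (F : fieldType) (A : invAlg F) : Prop :=
  exists (L : fieldType) (iota : {rmorphism F -> L}) (n : nat)
         (f : {rmorphism tensor A (ext_alg iota) -> 'M[L]_n.+1}) (g : 'M[L]_n.+1),
    [/\ bijective f,
        forall c : L, f (tens 1 (c : ext_alg iota)) = c%:M,
        g^T = g,
        g \in unitmx
      & forall (x : tensor A (ext_alg iota)) (u v : 'cV[L]_n.+1),
          u^T *m g *m (f x *m v) =
          (f (tensor_map invol idfun x) *m u)^T *m g *m v].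

Fixpoint inv_tensor_seq (F : fieldType) (Q : nat -> invAlg F) (r : nat) :=
  if r is r'.+1 then inv_tensor (inv_tensor_seq Q r') (Q r) else Q 0%N.

(* There are r.+1 factors Q 0, ..., Q r; values of Q beyond r are irrelevant. *)
Definition totally_decomposable (F : fieldType) (A : invAlg F) : Prop :=
  exists (r : nat) (Q : nat -> invAlg F),
    (forall i, (i <= r)%N -> quaternion (Q i)) /\
    inv_isomorphic A (inv_tensor_seq Q r).

Definition weakly_isotropic (A : nzRingType) (s : A -> A) : Prop :=
  exists (n : nat) (x : 'I_n.+1 -> A),
    (forall i, x i != 0) /\ \sum_i s (x i) * x i = 0.

Definition hyperbolic (A : nzRingType) (s : A -> A) : Prop :=
  exists e : A, e * e = e /\ s e = 1 - e.

Definition weakly_hyperbolic (F : fieldType) (A : invAlg F) : Prop :=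
  exists n : nat, hyperbolic (@invol F (inv_tensor (inv_matrix F n) A)).

(* Main.v *)
(* A quaternion algebra with involution has a basis 1, i, j, ij of monomials
   that are symmetric or skew and commute up to sign; hence so has a totally
   decomposable (A, sigma), with basis (e_x), and sigma(e_x) e_x = c_x is a
   scalar. The set T of sums of terms f^2 c_x is closed under + and *.
   If -1 = sum_k f_k^2 c_(x_k), choose orthogonal signed permutation matrices
   X_k such that the X_k (x) e_(x_k) are skew and anticommute: then
   g = sum_k f_k X_k (x) e_(x_k) is skew with g^2 = 1, and (1 + g)/2 witnesses
   that (A, sigma) is weakly hyperbolic.
   Otherwise T lies in an ordering of F, which extends to a semiordering S of K
   containing all the c_x. The coefficient at 1 of sigma(z) z, for
   z = sum_x e_x (x) y_x, is sum_x c_x y_x^2, so that (A, sigma)_K is not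
   weakly isotropic. *)
Require Import Defs.
From HB Require Import structures.
From mathcomp Require Import all_boot all_order all_algebra all_field.
From mathcomp Require Import boolp classical_sets ring.

Set Implicit Arguments.
Unset Strict Implicit.
Unset Printing Implicit Defensive.

Import GRing.Theory.
Local Open Scope ring_scope.

(** * Preorderings and semiorderings *)

Definition proper_preordering (F : fieldType) (T : F -> Prop) : Prop :=
  [/\ forall a, T (a ^+ 2),
      forall a b, T a -> T b -> T (a + b),
      forall a b, T a -> T b -> T (a * b)
    & ~ T (- 1)].

(** An equation [-1 = t - a * u] forces [u != 0], as [-1] is not in [T]; then [a = (1 + t) / u],
    which lies in [T] because dividing by [u] is multiplying by [u] and by the square of [u^-1]. *)
Lemma proper_preordering_adjoin (F : fieldType) (T : F -> Prop) (a : F) :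
  proper_preordering T -> ~ T a ->
  proper_preordering (fun x => exists t u, [/\ T t, T u & x = t - a * u]).
Proof.
move=> [Tsq TD TM TN1] Ta.
have T0 : T 0 by have := Tsq 0; rewrite expr0n.
split=> [b|_ _ [t [u [Tt Tu ->]]] [v [w [Tv Tw ->]]]|
         _ _ [t [u [Tt Tu ->]]] [v [w [Tv Tw ->]]]|[t [u [Tt Tu eq1]]]].
- by exists (b ^+ 2), 0; rewrite mulr0 subr0.
- exists (t + v), (u + w); split; [exact: TD|exact: TD|].
  by rewrite mulrDr opprD addrACA.
- exists (t * v + a ^+ 2 * (u * w)), (t * w + u * v).
  split; [|by apply: (TD); apply: (TM)|by ring].
  by apply: (TD); [apply: (TM)|apply: (TM) (Tsq a) (TM _ _ Tu Tw)].
- have u0 : u != 0.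
    by apply/eqP => u0; apply: TN1; rewrite eq1 u0 mulr0 subr0.
  apply: Ta; have -> : a = (1 + t) * u * u^-1 ^+ 2.
    have -> : t = a * u - 1 by rewrite eq1; ring.
    by field.
  apply: (TM); last exact: Tsq; apply: (TM) => //; apply: TD => //.
  by have := Tsq 1; rewrite expr1n.
Qed.

(** By Zorn's lemma [T] lies in a maximal proper preordering, which is an ordering and hence a
    semiordering. *)
Lemma proper_preordering_sub_semiordering (F : fieldType) (T : F -> Prop) :
  proper_preordering T -> exists2 P, semiordering P & forall x, T x -> P x.
Proof.
move=> Tp; have [Tsq TD TM TN1] := Tp.
(* Taking the union with [T] makes the empty chain harmless: its union is the empty set, which is
   good because [T] is a proper preordering. *)
pose good (X : set F) := proper_preordering (T `|` X)%classic.
have [G sG totG|X [Xp Xmax]] := @Zorn_bigcup F good.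
  have common x y : (T `|` \bigcup_(X in G) X)%classic x ->
      (T `|` \bigcup_(X in G) X)%classic y ->
      (T x /\ T y) \/
      exists X, [/\ G X, (T `|` X)%classic x & (T `|` X)%classic y].
    move=> [Tx|[X GX Xx]] [Ty|[Y GY Yy]]; first by left.
    - by right; exists Y; split=> //; [left|right].
    - by right; exists X; split=> //; [right|left].
    - have [XY|YX] := totG _ _ GX GY; right.
        by exists Y; split=> //; right=> //; apply: XY.
      by exists X; split=> //; right=> //; apply: YX.
  split=> [a|a b /common h/h|a b /common h/h|].
  - by left.
  - move=> [[Ta Tb]|[X [GX Xa Xb]]]; first by left; apply: TD.
    have [_ D _ _] := sG _ GX; have [|] := D _ _ Xa Xb; first by left.
    by right; exists X.
  - move=> [[Ta Tb]|[X [GX Xa Xb]]]; first by left; apply: TM.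
    have [_ _ D _] := sG _ GX; have [|] := D _ _ Xa Xb; first by left.
    by right; exists X.
  - by move=> [//|[X GX XN1]]; have [_ _ _] := sG _ GX; apply; right.
set P := (T `|` X)%classic in Xp.
have [Psq PD PM PN1] := Xp.
exists P; last by move=> x Tx; left.
have P0 : P 0 by have := Psq 0; rewrite expr0n.
have P1 : P 1 by have := Psq 1; rewrite expr1n.
split=> // [a x Px|x|x].
- exact: PM.
- have [Px|nPx] := pselect (P x); [by left|right].
  (* [Q] is [P - x P]. It contains [P] and [- x], so maximality puts [- x] in [P]. *)
  have := proper_preordering_adjoin Xp nPx.
  set Q := (fun _ => _) => Qp.
  have PQ : (P `<=` Q)%classic.
    by move=> y Py; exists y, 0; rewrite mulr0 subr0.
  have Qx : Q (- x) by exists 0, 1; rewrite mulr1 sub0r.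
  apply: contrapT => nPNx; apply: (Xmax Q).
    split; first by move=> y Xy; apply: PQ; right.
    by move=> /(_ _ Qx) XNx; apply: nPNx; right.
  suff -> : good Q = proper_preordering Q by [].
  rewrite /good; congr proper_preordering; apply/seteqP; split=> y /=.
    by case=> // Ty; apply: PQ; left.
  by right.
- split=> [[Px PNx]|->]; last by rewrite oppr0.
  apply/eqP/negP => /negP x0; apply: PN1.
  (* If a nonzero [x] and its opposite were both in [P], this product would put [-1] in [P]. *)
  have -> : -1 = x * - x * x^-1 ^+ 2.
    by rewrite mulrN -expr2 mulNr -exprMn divff // expr1n.
  by apply: (PM); [apply: (PM)|].
Qed.

(** * Signed permutation matrices with prescribed signs *)

(* Doubling the size adds one matrix: diag(X_k, theta_nk X_k) replaces X_k, and
   the new matrix is the block matrix [[0, eta_n], [1, 0]]. *)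
Lemma signed_permutation_matrices (F : fieldType) (n : nat)
    (eta : nat -> bool) (theta : nat -> nat -> bool) :
  exists (N : nat) (X : nat -> 'M[F]_N.+1),
    [/\ forall k, (k < n)%N -> (X k)^T = (-1) ^+ eta k *: X k,
        forall k, (k < n)%N -> (X k)^T * X k = 1
      & forall l k, (l < k < n)%N ->
          X k * X l = (-1) ^+ theta k l *: (X l * X k)].
Proof.
elim: n => [|n [N [X [Xt X1 Xc]]]].
  by exists 0%N, (fun=> 0); split=> // l k; rewrite ltn0 andbF.
pose D k : 'M[F]_(N.+1 + N.+1) :=
  block_mx (X k) 0 0 ((-1) ^+ theta n k *: X k).
pose Y : 'M[F]_(N.+1 + N.+1) := block_mx 0 ((-1) ^+ eta n)%:M 1%:M 0.
pose Z k := if (k < n)%N then D k else Y.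
exists (N + N.+1)%N, (Z : nat -> 'M[F]_((N + N.+1).+1)).
have sgn2 (b : bool) : (-1) ^+ b * (-1) ^+ b = 1 :> F.
  by rewrite -expr2 sqrr_sign.
have Zt k : (k < n.+1)%N -> (Z k)^T = (-1) ^+ eta k *: Z k.
  rewrite ltnS leq_eqVlt /Z => /predU1P[->|lt_kn]; rewrite ?ltnn ?lt_kn.
    rewrite tr_block_mx !trmx0 trmx1 tr_scalar_mx scale_block_mx !scaler0.
    by rewrite scale_scalar_mx sgn2 scalemx1.
  rewrite tr_block_mx !trmx0 linearZ /= Xt // scale_block_mx !scaler0 !scalerA.
  by rewrite mulrC.
have Z1 k : (k < n.+1)%N -> (Z k)^T *m Z k = 1%:M.
  rewrite ltnS leq_eqVlt /Z => /predU1P[->|lt_kn]; rewrite ?ltnn ?lt_kn.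
    rewrite tr_block_mx !trmx0 trmx1 tr_scalar_mx mulmx_block.
    rewrite !(mulmx0, mul0mx, addr0, add0r) mulmx1 -scalar_mxM sgn2.
    by rewrite -scalar_mx_block.
  have XX : (X k)^T *m X k = 1%:M by apply: X1.
  rewrite tr_block_mx !trmx0 linearZ /= mulmx_block.
  rewrite !(mulmx0, mul0mx, addr0, add0r) -scalemxAl -scalemxAr scalerA sgn2.
  by rewrite scale1r XX -scalar_mx_block.
have Zc l k : (l < k < n.+1)%N ->
    Z k *m Z l = (-1) ^+ theta k l *: (Z l *m Z k).
  case/andP=> lt_lk; rewrite ltnS leq_eqVlt /Z => /predU1P[eq_kn|lt_kn].
    (* [Y] interchanges the two diagonal blocks of [D l], which differ by the sign of
       [theta n l]. *)
    rewrite eq_kn in lt_lk *; rewrite ltnn lt_lk !mulmx_block.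
    rewrite !(mulmx0, mul0mx, addr0, add0r) mulmx1 mul1mx scale_block_mx.
    rewrite !scaler0 mul_mx_scalar mul_scalar_mx !scalerA sgn2 scale1r.
    by rewrite mulrC.
  rewrite lt_kn (ltn_trans lt_lk lt_kn) !mulmx_block.
  have XX : X k *m X l = (-1) ^+ theta k l *: (X l *m X k).
    by apply: Xc; rewrite lt_lk.
  rewrite !(mulmx0, mul0mx, addr0, add0r) scale_block_mx !scaler0.
  rewrite -!scalemxAl -!scalemxAr XX !scalerA; congr block_mx.
  by congr (_ *: _); ring.
by split.
Qed.

(** * Involutions and central simple algebras *)

Section Involution.
Variables (F : fieldType) (A : invAlg F).
Local Notation s := (@invol F A).

Lemma invol_is_linear : linear s.
Proof. by have [] := involP A. Qed.

HB.instance Definition _ :=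
  GRing.isLinear.Build F A A *:%R s invol_is_linear.

Lemma involM : {morph s : x y / x * y >-> y * x}.
Proof. by have [] := involP A. Qed.

Lemma involK : involutive s.
Proof. by have [] := involP A. Qed.

Lemma invol1 : s 1 = 1.
Proof. by rewrite -[LHS]mulr1 -{2}(involK 1) -involM mulr1 involK. Qed.

Lemma invol_alg k : s k%:A = k%:A.
Proof. by rewrite linearZ /= invol1. Qed.

Lemma sym_skew_split y : (2 : F) != 0 ->
  exists x z, [/\ s x = x, s z = - z & y = x + z].
Proof.
move=> nz2; exists (2^-1 *: (y + s y)), (2^-1 *: (y - s y)).
rewrite !linearZ /= (linearB s) (linearD s) /= involK -scalerDr addrACA subrr.
rewrite addr0.
split; [by rewrite addrC | by rewrite opprB | ].
by rewrite -mulr2n -scaler_nat scalerA mulVf // scale1r.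
Qed.

End Involution.

Section CentralSimple.
Variables (F : fieldType) (A : falgType F).
Hypothesis csA : central_simple A.
Implicit Types x y z : A.

Lemma central_simple_center x : (forall y, x * y = y * x) -> exists k, x = k%:A.
Proof.
move=> xC; have: x \in 'Z({:A})%VS.
  by rewrite memv_cap memvf; apply/centvP => y _; apply: xC.
by rewrite csA.1 => /vlineP.
Qed.

(** The two-sided ideal [U] generated by [x] has [U * U = 0], since [x A x = 0]. By simplicity it is
    zero, or it contains 1, which would then lie in [U * U]. *)
Lemma central_simple_semiprime x : (forall y, x * y * x = 0) -> x = 0.
Proof.
move=> x0; pose U := ({:A} * <[x]> * {:A})%VS.
have xAx : (<[x]> * {:A} * <[x]> = 0)%VS.
  have sub0 : (<[x]> * {:A} <= lker (amulr x))%VS.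
    apply/prodvP => _ y /vlineP[k ->] _.
    by rewrite memv_ker lfunE /= -!scalerAl x0 scaler0.
  apply/eqP; rewrite -subv0; apply/prodvP => y _ /(subvP sub0) + /vlineP[k ->].
  by rewrite memv_ker lfunE /= => /eqP yx; rewrite -scalerAr yx scaler0 mem0v.
have [U0|U1] : U = 0%VS \/ U = {:A}%VS.
- apply: csA.2; first by rewrite /U !prodvA !prodvSl ?subvf.
  by rewrite /U -prodvA prodvSr ?subvf.
- apply/eqP; rewrite -memv0 -U0 -[x]mulr1 -[x]mul1r.
  by rewrite !memv_mul ?memvf ?memv_line.
- have : (1 : A) \in (U * U)%VS by rewrite -[1]mulr1 memv_mul ?U1 ?memvf.
  have -> : (U * U = 0)%VS.
    have -> : (U * U = {:A} * (<[x]> * ({:A} * {:A}) * <[x]>) * {:A})%VS.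
      by rewrite /U !prodvA.
    apply/eqP; rewrite -subv0 -[X in (_ <= X)%VS](prod0v {:A}%VS) prodvSl //.
    rewrite -[X in (_ <= X)%VS](prodv0 {:A}%VS) prodvSr // -xAx.
    by rewrite prodvSl ?prodvSr ?subvf.
  by rewrite memv0 oner_eq0.
Qed.

(** Moving [x] past [y] turns [x * y * x] into a multiple of [x * x]. This is how the quaternion
    generators are shown to have nonzero squares. *)
Lemma central_simple_normal_nilpotent x :
  (forall y, exists y', x * y = y' * x) -> x * x = 0 -> x = 0.
Proof.
move=> xN xx; apply: central_simple_semiprime => y.
by have [y' ->] := xN y; rewrite -mulrA xx mulr0.
Qed.

End CentralSimple.

(** * Generators of a quaternion algebra adapted to the involution *)

(** On a quaternion algebra in characteristic different from 2, [n] is true for the canonical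
    involution, and false for an orthogonal one, whose skew elements form the line through [i]. *)
Definition quaternion_generators (F : fieldType) (Q : invAlg F) : Prop :=
  exists (i j : Q) (a b : F) (n : bool),
    [/\ a != 0 /\ b != 0, i * i = a%:A /\ j * j = b%:A, i * j = - (j * i),
        invol i = - i & invol j = (-1) ^+ n *: j].

Section QuaternionInvolution.
Variables (F : fieldType) (Q : invAlg F).
Hypotheses (nz2 : (2 : F) != 0) (csQ : central_simple Q).
Local Notation s := (@invol F Q).
Implicit Types x y z u v : Q.

Lemma self_opp_eq0 x : x = - x -> x = 0.
Proof.
move/eqP; rewrite -addr_eq0 -mulr2n -scaler_nat scaler_eq0 (negPf nz2).
by move/eqP.
Qed.

(** This is the canonical involution. Squaring is a quadratic form on the skew elements, with polar
    form [u * v + v * u]. An anisotropic vector [i] and an anisotropic [j] orthogonal to it are the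
    generators; the form cannot vanish where they are sought, since that would yield a nonzero
    normal element of square zero. *)
Lemma scalar_sym_generators :
  (forall x, s x = x -> exists k, x = k%:A) ->
  (forall u, exists2 v, s v = - v & forall k, v <> k *: u) ->
  quaternion_generators Q.
Proof.
move=> symF skew2.
have split_scalar y : exists k v, s v = - v /\ y = k%:A + v.
  have [x [v [/symF[k ->] sv ->]]] := sym_skew_split y nz2.
  by exists k, v.
have sq u : s u = - u -> exists k, u * u = k%:A.
  by move=> su; apply: symF; rewrite involM su mulrNN.
have polar u v : s u = - u -> s v = - v -> exists k, u * v + v * u = k%:A.
  by move=> su sv; apply: symF; rewrite linearD /= !involM su sv !mulrNN addrC.
have polar0 (W : Q -> Prop) : (forall u v, W u -> W v -> W (u + v)) ->
    (forall u, W u -> u * u = 0) -> forall u v, W u -> W v -> u * v = - (v * u).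
  move=> WD W0 u v Wu Wv; apply/eqP; rewrite -addr_eq0; apply/eqP.
  have := W0 _ (WD _ _ Wu Wv).
  by rewrite mulrDl !mulrDr !W0 // addr0 add0r.
have skewD u v : s u = - u -> s v = - v -> s (u + v) = - (u + v).
  by move=> su sv; rewrite linearD /= su sv opprD.
have [i si ii] : exists2 i, s i = - i & i * i <> 0.
  apply: contrapT => nex.
  have W0 u : s u = - u -> u * u = 0.
    by move=> su; apply: contrapT => uu; apply: nex; exists u.
  (* A skew element that is no multiple of 0 is a nonzero one. *)
  have [u su u0] := skew2 0; apply: (u0 0); rewrite scale0r.
  apply: (central_simple_normal_nilpotent csQ) (W0 _ su) => y.
  (* The witness is the conjugate of [y]: [u] commutes with scalars and anticommutes with skew
     elements. *)
  have [k [v [sv ->]]] := split_scalar y; exists (k%:A - v).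
  rewrite mulrDr mulrBl mulr_algl mulr_algr (polar0 _ skewD W0 u v) //.
have [a iia] := sq _ si.
have a0 : a != 0 by apply/eqP => a0; apply: ii; rewrite iia a0 scale0r.
pose W v := s v = - v /\ i * v = - (v * i).
have WD u v : W u -> W v -> W (u + v).
  move=> [su iu] [sv iv]; split; first exact: skewD.
  by rewrite mulrDr mulrDl iu iv opprD.
have proj v : s v = - v -> exists k w, W w /\ v = k *: i + w.
  move=> sv; have [k iv] := polar _ _ si sv.
  (* Orthogonal projection off [i]: the polar form takes the value [k] at [i] and [v], and [2 * a]
     at [i] and [i]. *)
  exists (k / (2 * a)), (v - (k / (2 * a)) *: i); split; last first.
    by rewrite addrC subrK.
  split; first by rewrite linearB linearZ /= si sv scalerN opprK opprB addrC.
  apply/eqP; rewrite -addr_eq0 mulrBr mulrBl addrACA iv -opprD.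
  rewrite -scalerAl -scalerAr iia -scalerDr -scalerDl scalerA -scalerBl.
  by apply/eqP; rewrite [X in X *: _](_ : _ = 0) ?scale0r //; field; rewrite a0.
have [j [[sj ij] jj]] : exists j, W j /\ j * j <> 0.
  apply: contrapT => nex.
  have W0 u : W u -> u * u = 0.
    by move=> Wu; apply: contrapT => uu; apply: nex; exists u.
  (* The component [j] of [v] orthogonal to [i] is nonzero, as [v] is no multiple of [i]. Were all
     squares in [W] zero, [j] would be normal of square zero. *)
  have [v sv v0] := skew2 i; have [k [j [Wj vE]]] := proj _ sv.
  suff j0 : j = 0 by apply: (v0 k); rewrite vE j0 addr0.
  apply: (central_simple_normal_nilpotent csQ) (W0 _ Wj) => y.
  have [k1 [z [sz ->]]] := split_scalar y; have [l [w [Ww ->]]] := proj _ sz.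
  exists (k1%:A - (l *: i + w)).
  rewrite mulrDr mulrBl mulr_algl mulr_algr; congr (_ + _).
  rewrite mulrDr mulrDl (polar0 W _ _ j w) // opprD -scalerAl -scalerAr.
  by have [_ ->] := Wj; rewrite scalerN opprK.
have [b jjb] := sq _ sj.
have b0 : b != 0 by apply/eqP => b0; apply: jj; rewrite jjb b0 scale0r.
by exists i, j, a, b, true; split=> //; rewrite expr1 scaleN1r.
Qed.

(** This is the orthogonal case. For symmetric [x] the element [u * x + x * u] is skew, hence a
    multiple of [u], so a scalar correction of [x] anticommutes with [u]. Thus the algebra is
    [F + F u + W], with [W] the symmetric elements anticommuting with [u], and [j] is found in
    [W]. *)
Lemma skew_line_generators u : s u = - u -> u <> 0 ->
  (forall v, s v = - v -> exists k, v = k *: u) -> quaternion_generators Q.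
Proof.
move=> su u0 skewF.
pose W x := s x = x /\ u * x = - (x * u).
have WD x y : W x -> W y -> W (x + y).
  move=> [su1 iu] [sv iv]; split; first by rewrite linearD /= su1 sv.
  by rewrite mulrDr mulrDl iu iv opprD.
have proj y : exists k l w, W w /\ y = k%:A + l *: u + w.
  have [x [z [sx sz ->]]] := sym_skew_split y nz2.
  have [l ->] := skewF _ sz.
  have [|k ux] := skewF (u * x + x * u).
    by rewrite linearD /= !involM su sx mulrN mulNr -opprD addrC.
  exists (k / 2), l, (x - (k / 2)%:A); split; last first.
    by rewrite addrAC addrCA subrr addr0 addrC.
  split; first by rewrite linearB /= invol_alg sx.
  apply/eqP; rewrite -addr_eq0 mulrBr mulrBl addrACA ux -opprD mulr_algl.
  rewrite mulr_algr -scalerDl -scalerBl [X in X *: _](_ : _ = 0) ?scale0r //.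
  by field.
(* [u * u] is central: it commutes with [u], and with [W] after two changes of sign. *)
have [a uua] : exists a, u * u = a%:A.
  apply: (central_simple_center csQ) => y.
  have [k [l [w [[_ uw] ->]]]] := proj y.
  rewrite !mulrDr !mulrDl mulr_algl mulr_algr -!scalerAl -!scalerAr !mulrA.
  congr (_ + _).
  by rewrite -mulrA uw mulrN mulrA uw mulNr opprK.
have a0 : a != 0.
  apply/eqP => a0; apply: u0.
  apply: (central_simple_normal_nilpotent csQ); last by rewrite uua a0 scale0r.
  move=> y; have [k [l [w [[_ uw] ->]]]] := proj y.
  exists (k%:A + l *: u - w).
  rewrite mulrDr mulrBl uw mulrDl mulrDr mulr_algl mulr_algr.
  by rewrite -scalerAl -scalerAr.
have sq x : W x -> exists b, x * x = b%:A.
  move=> [sx ux]; have [|k] := skewF (u * (x * x) + (x * x) * u).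
    by rewrite linearD /= !involM su sx mulrN mulNr -opprD addrC.
  have -> : u * (x * x) = x * x * u.
    by rewrite mulrA ux mulNr -(mulrA x u) ux mulrN opprK mulrA.
  rewrite -mulr2n -scaler_nat => xxu; exists (k / 2).
  (* Multiplying by [u], whose square is the nonzero scalar [a], cancels [u] from the equation. *)
  have: 2 *: (x * x * u) * u = k *: u * u by rewrite xxu.
  rewrite -!scalerAl -(mulrA (x * x)) uua mulr_algr.
  move=> /(congr1 (fun z => (2 * a)^-1 *: z)).
  rewrite /= !scalerA -[_ * 2 * a]mulrA mulVf ?mulf_neq0 // scale1r => ->.
  by congr (_ *: _); field; rewrite a0 nz2.
have [j [[sj uj] jj]] : exists j, W j /\ j * j <> 0.
  apply: contrapT => nex.
  have W0 x : W x -> x * x = 0.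
    by move=> Wx; apply: contrapT => xx; apply: nex; exists x.
  have polar0 x y : W x -> W y -> x * y = - (y * x).
    move=> Wx Wy; apply/eqP; rewrite -addr_eq0; apply/eqP.
    have := W0 _ (WD _ _ Wx Wy).
    by rewrite mulrDl !mulrDr !W0 // addr0 add0r.
  have W00 x : W x -> x = 0.
    move=> Wx; apply: (central_simple_normal_nilpotent csQ) (W0 _ Wx) => y.
    have [k [l [w [Ww ->]]]] := proj y; exists (k%:A - l *: u - w).
    rewrite mulrDr mulrBl (polar0 x w) // mulrBl mulrDr mulr_algl mulr_algr.
    by rewrite -scalerAl -scalerAr Wx.2 scalerN opprK.
  (* With [W = 0] the algebra is [F + F u], so [u] is central, hence scalar, hence both symmetric
     and skew. *)
  have [k uk] : exists k, u = k%:A.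
    apply: (central_simple_center csQ) => y.
    have [k [l [w [/W00-> ->]]]] := proj y.
    by rewrite addr0 mulrDl mulrDr mulr_algl mulr_algr -scalerAl -scalerAr.
  by apply: u0; apply: self_opp_eq0; rewrite -su {2}uk invol_alg.
have [b jjb] := sq j (conj sj uj).
have b0 : b != 0 by apply/eqP => b0; apply: jj; rewrite jjb b0 scale0r.
by exists u, j, a, b, false; split=> //; rewrite expr0 scale1r.
Qed.

(* Otherwise the symmetric elements are F + F z with z^2 in F, and [z, [z, y]]
   = 0 for all y, as [z, y] is symmetric for y skew; this reads z y z = z^2 y,
   which makes z central if z^2 != 0 and contradicts simplicity if z^2 = 0. *)
Lemma sym_plane_scalar x : s x = x ->
  (forall y, s y = y -> exists k l, y = k%:A + l *: x) -> exists k, x = k%:A.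
Proof.
move=> sx0 symF0.
have [p [q xx]] : exists p q, x * x = p%:A + q *: x.
  by apply: symF0; rewrite involM sx0.
(* Completing the square makes [z * z] scalar. *)
pose z := x - (q / 2)%:A.
have sz : s z = z by rewrite /z linearB /= invol_alg sx0.
have xE : x = (q / 2)%:A + z by rewrite addrC subrK.
have symF y : s y = y -> exists k l, y = k%:A + l *: z.
  move=> /symF0[k [l ->]]; exists (k + l * (q / 2)), l.
  by rewrite {1}xE scalerDr addrA scalerDl scalerA.
suff [k zE] : exists k, z = k%:A.
  by exists (q / 2 + k); rewrite xE zE scalerDl.
have [b zz] : exists b, z * z = b%:A.
  exists (p + q ^+ 2 / 4).
  rewrite /z mulrBr !mulrBl xx mulr_algl !mulr_algr scalerA.
  rewrite opprB addrA.
  have -> : q *: x = (q / 2) *: x + (q / 2) *: x.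
    by rewrite -scalerDl; congr (_ *: _); field.
  rewrite addrA addrK addrAC addrK -scalerDl.
  congr (_ *: _); field.
  have -> : (4 : F) = 2 * 2 by ring.
  by rewrite mulf_neq0 ?nz2.
clearbody z.
have zyz y : z * y * z = b *: y.
  have [t [v [/symF[k [l ->]] sv ->]]] := sym_skew_split y nz2.
  have zvz : z * v * z = b *: v.
    have [|k1 [l1 com]] := symF (z * v - v * z).
      by rewrite linearB /= !involM sz sv mulNr mulrN opprK addrC.
    have : z * (z * v - v * z) = (z * v - v * z) * z.
      by rewrite com mulrDl mulrDr mulr_algl mulr_algr -scalerAl -scalerAr.
    rewrite mulrBr mulrBl mulrA zz mulr_algl -(mulrA v) zz mulr_algr mulrA.
    move/eqP; rewrite subr_eq addrAC -subr_eq opprK -!mulr2n -!scaler_nat.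
    by move=> /eqP/(scalerI nz2).
  rewrite mulrDr mulrDl zvz scalerDr; congr (_ + _).
  rewrite mulrDr mulrDl mulr_algr -!scalerAl -scalerAr -scalerAl. 
  by rewrite !zz mulr_algl scalerDr !(scalerA b) !(mulrC b) -!scalerA.
have [b0|b0] := eqVneq b 0.
  exists 0; rewrite scale0r; apply: (central_simple_semiprime csQ) => y.
  by rewrite zyz b0 scale0r.
apply: (central_simple_center csQ) => y; apply: (scalerI b0).
by rewrite [RHS]scalerAl -(zyz y) -[RHS]mulrA zz mulr_algr.
Qed.

End QuaternionInvolution.

(** The dimensions of the symmetric part [S] and the skew part [K] add up to 4. The cases
    [\dim S <= 1] and [\dim K <= 1] lead to the two constructions above; the remaining case, both
    equal to 2, is impossible. *)
Lemma quaternion_has_generators (F : fieldType) (Q : invAlg F) :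
  (2 : F) != 0 -> quaternion Q -> quaternion_generators Q.
Proof.
move=> nz2 [csQ dimQ].
pose S := lker (linfun (@invol F Q) - \1)%VF.
pose K := lker (linfun (@invol F Q) + \1)%VF.
have memS x : (x \in S) = (invol x == x).
  by rewrite memv_ker add_lfunE opp_lfunE lfunE id_lfunE subr_eq0.
have memK x : (x \in K) = (invol x == - x).
  by rewrite memv_ker add_lfunE lfunE id_lfunE addr_eq0.
have SKf : (S + K = fullv)%VS.
  apply/eqP; rewrite eqEsubv subvf /=; apply/subvP => y _.
  have [x [z [sx sz ->]]] := sym_skew_split y nz2.
  by rewrite memv_add // ?memS ?memK ?sx ?sz.
have SK0 : (S :&: K = 0)%VS.
  apply/eqP; rewrite -subv0; apply/subvP => x.
  rewrite memv_cap memS memK => /andP[/eqP-> /eqP xN].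
  by rewrite (self_opp_eq0 nz2 xN) mem0v.
have dSK : (\dim S + \dim K = 4)%N by rewrite -dimv_disjoint_sum // SKf.
have S1 : (1 <= S)%VS.
  by apply/subvP => _ /vlineP[k ->]; rewrite memS invol_alg.
have [dS1|dS1] := leqP (\dim S) 1.
  have SE : S = 1%VS by apply/esym/eqP; rewrite eqEdim S1 dimv1.
  apply: scalar_sym_generators => // [x sx|u].
    by apply/vlineP; rewrite -SE memS sx.
  have : ~~ (K <= <[u]>)%VS.
    apply/negP => /dimvS; rewrite dim_vline => Ku.
    have := leq_add dS1 Ku; rewrite dSK; by case: (u != 0).
  case/subvPn => v; rewrite memK => /eqP sv vu; exists v => // k vE.
  by case/negP: vu; rewrite vE memvZ ?memv_line.
have [dK1|dK1] := leqP (\dim K) 1.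
  have [K0|nzK] := eqVneq K 0%VS.
    (* If the involution is the identity, the algebra is commutative and equals its center, of
       dimension 1. *)
    have Sf (x : Q) : invol x = x.
      apply/eqP; rewrite -memS; move: SKf; rewrite K0 addv0 => ->.
      exact: memvf.
    have : ({:Q} <= 1)%VS.
      apply/subvP => x _; apply/vlineP.
      by apply: (central_simple_center csQ) => y; rewrite -[LHS]Sf involM !Sf.
    by move/dimvS; rewrite dimQ dimv1.
  have u0 : vpick K != 0 by rewrite vpick0.
  have KE : K = <[vpick K]>%VS.
    by apply/esym/eqP; rewrite eqEdim -memvE memv_pick dim_vline u0.
  apply: (skew_line_generators nz2 csQ (u := vpick K)).
  - by apply/eqP; rewrite -memK memv_pick.
  - exact/eqP.
  - by move=> v sv; apply/vlineP; rewrite -KE memK sv.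
have dS2 : (\dim S <= 2)%N.
  by rewrite -(leq_add2r (\dim K)) dSK (leq_add2l 2 2).
have : ~~ (S <= 1)%VS.
  by apply/negP => /dimvS; rewrite dimv1 leqNgt dS1.
case/subvPn => x; rewrite memS => /eqP sx x1; case/negP: (x1).
apply/vlineP; apply: (sym_plane_scalar nz2 csQ sx) => y sy.
have WS : (1 + <[x]> <= S)%VS by rewrite subv_add S1 -memvE memS sx eqxx.
have [W1|W2] := leqP (\dim (1 + <[x]>)%VS) 1.
  have WE : (1 + <[x]> = 1)%VS.
    by apply/esym/eqP; rewrite eqEdim addvSl dimv1.
  by case/negP: x1; rewrite memvE -[X in (_ <= X)%VS]WE addvSr.
have : y \in (1 + <[x]>)%VS.
  suff -> : (1 + <[x]> = S)%VS by rewrite memS sy.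
  by apply/eqP; rewrite eqEdim WS (leq_trans dS2).
case/memv_addP => _ /vlineP[k ->] [_ /vlineP[l ->] ->].
by exists k, l.
Qed.

(** * Monomial bases of totally decomposable algebras *)

(** [tau] is the coefficient at 1. Linear independence of [e] is encoded in [monomial_trace], which
    makes [e] orthogonal with nonzero norms. The last two fields make the sums of terms
    [f ^+ 2 * c i] closed under products and let them include the squares. *)
Record monomial_basis (F : fieldType) (A : invAlg F) (I : finType)
    (e : I -> A) (c : I -> F) (tau : A -> F) : Prop := MonomialBasis {
  monomial_span : forall x, exists k : I -> F, x = \sum_i k i *: e i;
  monomial_sym : forall i, exists n : bool, invol (e i) = (-1) ^+ n *: e i;
  monomial_norm : forall i, invol (e i) * e i = (c i)%:A;
  monomial_comm : forall i j, exists n : bool,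
    e i * e j = (-1) ^+ n *: (e j * e i);
  monomial_trace_linear : scalar tau;
  monomial_trace : forall i j,
    tau (invol (e i) * e j) = if i == j then c i else 0;
  monomial_norm_neq0 : forall i, c i != 0;
  monomial_norm_mul : forall i j, exists f k, c i * c j = f ^+ 2 * c k;
  monomial_norm_one : exists i, c i = 1
}.

Definition has_monomial_basis (F : fieldType) (A : invAlg F) : Prop :=
  exists (I : finType) (e : I -> A) (c : I -> F) (tau : A -> F),
    monomial_basis e c tau.

(** Up to nonzero scalars the four monomials multiply like the group (Z/2)^2. Multiplying by [e w]
    on both sides scales each [e x] by a sign and a common factor; these signs separate the indices
    and give independence, and dimension 4 does the rest. *)
Lemma quaternion_monomial_basis (F : fieldType) (Q : invAlg F) :
  (2 : F) != 0 -> quaternion Q -> has_monomial_basis Q.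
Proof.
move=> nz2 quatQ; have [_ dimQ] := quatQ.
have [i [j [a [b [n [[a0 b0] [ii jj] ij si sj]]]]]] :=
  quaternion_has_generators nz2 quatQ.
pose e (x : bool * bool) : Q := i ^+ x.1 * j ^+ x.2.
pose P (d : F) (p q : bool) := if p && q then d else 1.
pose c (x : bool * bool) := P (- a) x.1 x.1 * P ((-1) ^+ n * b) x.2 x.2.
have ji p q : j ^+ nat_of_bool q * i ^+ nat_of_bool p =
    (-1) ^+ (p && q) *: (i ^+ p * j ^+ q).
  case: p q => -[]; rewrite ?(expr0, expr1, mul1r, mulr1, scale1r) //.
  by rewrite scaleN1r ij opprK.
have iP (p q : bool) : i ^+ p * i ^+ q = P a p q *: i ^+ (p (+) q).
  by case: p q => -[]; rewrite ?(expr0, expr1, mul1r, mulr1, scale1r).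
have jP (p q : bool) : j ^+ p * j ^+ q = P b p q *: j ^+ (p (+) q).
  by case: p q => -[]; rewrite ?(expr0, expr1, mul1r, mulr1, scale1r).
have eM x y : e x * e y = ((-1) ^+ (x.2 && y.1) * (P a x.1 y.1 * P b x.2 y.2))
    *: e (x.1 (+) y.1, x.2 (+) y.2).
  rewrite /e /= -mulrA (mulrA (j ^+ _)) ji -scalerAl -scalerAr -mulrA jP.
  rewrite mulrA iP -scalerAl -scalerAr !scalerA andbC.
  by congr (_ *: _); rewrite mulrA.
have sX (z : Q) (d : bool) (p : bool) : invol z = (-1) ^+ d *: z ->
    invol (z ^+ p) = (-1) ^+ (d && p) *: z ^+ p.
  by case: p => sz; rewrite ?andbT ?andbF ?expr1 ?expr0 ?scale1r // invol1.
have sE x : invol (e x) = (-1) ^+ (x.1 (+) (n && x.2) (+) (x.1 && x.2)) *: e x.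
  rewrite involM (sX _ n) // (sX _ true) /=; last by rewrite scaleN1r.
  rewrite -scalerAl -scalerAr ji !scalerA !signr_addb.
  by congr (_ *: _); ring.
have PC d p q : P d p q = P d q p by rewrite /P andbC.
have comb (k k' : bool * bool -> F) t : \sum_x k x *: e x = 0 ->
    \sum_x k' x *: e x = 0 -> \sum_x (k x + t * k' x) *: e x = 0.
  move=> k0 k'0; under eq_bigr do rewrite scalerDl -scalerA.
  by rewrite big_split /= -scaler_sumr k0 k'0 scaler0 addr0.
have conj w x : e w * e x * e w =
    ((-1) ^+ (w.1 && x.2 (+) w.2 && x.1) * (P a w.1 w.1 * P b w.2 w.2)
      * (-1) ^+ (w.1 && w.2)) *: e x.
  rewrite eM -scalerAl eM scalerA; case: w x => -[] [] [[] []] /=;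
  by congr (_ *: _); rewrite /P /=; ring.
have twist w k : \sum_x k x *: e x = 0 ->
    \sum_x ((-1) ^+ (w.1 && x.2 (+) w.2 && x.1) * k x) *: e x = 0.
  move=> k0; pose d := P a w.1 w.1 * P b w.2 w.2 * (-1) ^+ (w.1 && w.2).
  have d0 : d != 0.
    by rewrite !mulf_neq0 ?signr_eq0 // /P; case: ifP; rewrite ?oner_eq0.
  apply: (scalerI d0).
  rewrite scaler0 -[RHS](mul0r (e w)) -[in RHS](mulr0 (e w)).
  rewrite scaler_sumr -[in RHS]k0 mulr_sumr mulr_suml; apply: eq_bigr => x _.
  rewrite -scalerAr -scalerAl conj !scalerA; congr (_ *: _); rewrite /d; ring.
(* Take the middle factor of [conj] to be 1: the square of [e y] is a nonzero scalar. *)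
have e0 y : e y != 0.
  apply/eqP => y0; have := conj y (false, false).
  rewrite y0 !mul0r => /esym/eqP; rewrite scaler_eq0 /e mulr1 oner_eq0 orbF.
  apply/negP; rewrite !mulf_neq0 ?signr_eq0 //.
    by rewrite /P; case: ifP; rewrite ?oner_eq0.
  by rewrite /P; case: ifP; rewrite ?oner_eq0.
have indep (k : bool * bool -> F) : \sum_x k x *: e x = 0 -> forall y, k y = 0.
  move=> k0 y.
  (* The first combination kills the terms with [x.2 != y.2], the second those with [x.1 != y.1];
     what remains is [4 * k y] times [e y]. *)
  have k1 := comb _ _ ((-1) ^+ y.2) k0 (twist (true, false) k k0).
  have := comb _ _ ((-1) ^+ y.1) k1 (twist (false, true) _ k1).
  rewrite (bigD1 y) //= big1 => [|x]; last first.
    case: x y {k1} => -[] [] [[] []] //= _; apply/eqP;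
    rewrite scaler_eq0; apply/orP; left; apply/eqP; ring.
  rewrite addr0 => /eqP; rewrite scaler_eq0 (negPf (e0 _)) orbF => /eqP k4.
  apply/eqP; move/eqP: k4.
  rewrite (_ : _ + _ = 2 * 2 * k y) ?mulf_eq0 ?(negPf nz2) //.
  by case: y {k1} => -[] [] /=; ring.
pose X := [tuple e (enum_val m) | m < #|{: bool * bool}|].
have XE (m : 'I_#|{: bool * bool}|) : X`_m = e (enum_val m).
  by rewrite -tnth_nth tnth_mktuple.
have freeX : free X.
  apply/freeP => k kX m; rewrite -[m]enum_valK.
  apply: (indep (fun x => k (enum_rank x))); rewrite -[RHS]kX.
  rewrite (reindex_onto (enum_val : 'I_#|{: bool * bool}| -> _) enum_rank) /=.
    by apply: eq_big => [l|l _]; rewrite enum_valK ?eqxx ?XE.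
  by move=> x _; rewrite enum_rankK.
have bX : basis_of fullv X.
  by rewrite basisEfree freeX subvf dimQ size_tuple card_prod card_bool.
pose tau (x : Q) := coord X (enum_rank (false, false)) x.
have tauE x : tau (e x) = (x == (false, false))%:R.
  rewrite /tau -{1}[x]enum_rankK -XE coord_free //.
  by rewrite (inj_eq enum_rank_inj).
exists (bool * bool)%type, e, c, tau; split.
- move=> x; exists (fun y => coord X (enum_rank y) x).
  rewrite {1}(coord_basis bX (memvf x)).
  rewrite [RHS](reindex_onto
    (enum_val : 'I_#|{: bool * bool}| -> _) enum_rank) /=.
    by apply: eq_big => [l|l _]; rewrite enum_valK ?eqxx ?XE.
  by move=> y _; rewrite enum_rankK.
- by move=> x; eexists; apply: sE.
- move=> x; rewrite sE -scalerAl eM scalerA !addbb /e mulr1.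
  by congr (_ *: _); rewrite /c /P; case: x (n) => -[] [] [] /=; ring.
- move=> x y; exists ((x.2 && y.1) (+) (y.2 && x.1)).
  rewrite !eM scalerA signr_addb (PC a y.1) (PC b y.2) (addbC y.1) (addbC y.2).
  by congr (_ *: _); rewrite -[RHS]mulrA signrMK.
- exact: linearP.
- move=> x y; rewrite sE -scalerAl eM scalerA /tau linearZ /= -/(tau _) tauE.
  case: (x =P y) => [<-|xy].
    rewrite !addbb eqxx mulr1; rewrite /c /P; case: x (n) => -[] [] [] /=; ring.
  case: eqP => [[]|]; last by rewrite mulr0.
  by case: x y xy => -[] [] [[] []].
- move=> x; rewrite mulf_neq0 // /P; case: ifP; rewrite ?oner_eq0 ?oppr_eq0 //.
  by rewrite mulf_neq0 ?signr_eq0.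
- move=> x y; exists (P (- a) x.1 y.1 * P ((-1) ^+ n * b) x.2 y.2).
  exists (x.1 (+) y.1, x.2 (+) y.2).
  by rewrite /c /P; case: x y => [[] []] [[] []] /=; ring.
- by exists (false, false); rewrite /c /P mulr1.
Qed.

Lemma tens_lincomb (F : fieldType) (A : vectType F) (B : lmodType F)
    (I : finType) (e : I -> A) (x : tensor A B) :
  (forall a, exists k : I -> F, a = \sum_i k i *: e i) ->
  exists y : I -> B, x = \sum_i tens (e i) (y i).
Proof.
move=> eA; elim/tensor_ind: x => [a b|_ _ [y ->] [y' ->]].
  have [k ->] := eA a; exists (fun i => k i *: b); rewrite tens_suml.
  by apply: eq_bigr => i _; rewrite tensZl tensZr.
exists (fun i => y i + y' i); rewrite -big_split.
by apply: eq_bigr => i _; rewrite tensDr.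
Qed.

Lemma monomial_basis_tensor (F : fieldType) (A B : invAlg F) :
  has_monomial_basis A -> has_monomial_basis B ->
  has_monomial_basis (inv_tensor A B).
Proof.
move=> [I [e [c [t [eS es eN eC tL tE c0 cM [i1 c1]]]]]].
move=> [I' [e' [c' [t' [eS' es' eN' eC' tL' tE' c0' cM' [i1' c1']]]]]].
(* The coefficient form of the tensor product is the product of the two forms. *)
have [||g [gL gE _]] := @tensor_universal F A B F^o (fun a b => t a * t' b).
- by move=> b k u v; rewrite tL mulrDl -mulrA.
- by move=> a k u v; rewrite tL' mulrDr mulrCA.
exists (I * I')%type, (fun i => tens (e i.1) (e' i.2)),
  (fun i => c i.1 * c' i.2), g.
have sE (a : A) (b : B) :
    @invol F (inv_tensor A B) (tens a b) = tens (invol a) (invol b).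
  exact: tensor_mapE.
split.
- move=> x; have [y ->] := tens_lincomb x eS.
  have /fin_all_exists [k kE] i : exists k : I' -> F, y i = \sum_j k j *: e' j.
    exact: eS'.
  exists (fun i => k i.1 i.2).
  rewrite -(pair_bigA _ (fun i j => k i j *: tens (e i) (e' j))) /=.
  apply: eq_bigr => i _; rewrite kE tens_sumr.
  by apply: eq_bigr => j _; rewrite tensZr.
- move=> [i j]; have [n sn] := es i; have [n' sn'] := es' j.
  by exists (n (+) n'); rewrite sE sn sn' tensZl tensZr scalerA signr_addb.
- by move=> [i j]; rewrite sE tensM eN eN' tensZl tensZr scalerA.
- move=> [i j] [k l] /=; have [n sn] := eC i k; have [n' sn'] := eC' j l.
  by exists (n (+) n'); rewrite !tensM sn sn' tensZl tensZr scalerA signr_addb.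
- exact: gL.
- move=> [i j] [k l]; rewrite sE tensM gE tE tE' xpair_eqE /=.
  by do 2!case: eqP; rewrite ?mul0r ?mulr0.
- by move=> [i j]; rewrite mulf_neq0.
- move=> [i j] [k l] /=; have [f [m fE]] := cM i k.
  have [f' [m' fE']] := cM' j l; exists (f * f'), (m, m').
  by rewrite /= mulrACA fE fE' exprMn mulrACA.
- by exists (i1, i1'); rewrite /= c1 c1' mulr1.
Qed.

Lemma monomial_basis_isomorphic (F : fieldType) (A B : invAlg F) :
  inv_isomorphic A B -> has_monomial_basis B -> has_monomial_basis A.
Proof.
move=> [f [g fK gK] fs] [I [e [c [t [eS es eN eC tL tE c0 cM c1]]]]].
have fI := can_inj fK.
exists I, (g \o e), c, (t \o f); split=> //=.
- move=> x; have [k kE] := eS (f x); exists k; apply: fI.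
  by rewrite kE linear_sum; apply: eq_bigr => i _; rewrite linearZ /= gK.
- move=> i; have [n sn] := es i; exists n; apply: fI.
  by rewrite fs linearZ /= gK.
- by move=> i; apply: fI; rewrite rmorphM linearZ /= fs gK eN rmorph1.
- move=> i j; have [n sn] := eC i j; exists n; apply: fI.
  by rewrite linearZ /= !rmorphM /= !gK.
- by move=> k u v; rewrite /= linearP tL.
- by move=> i j; rewrite rmorphM /= fs !gK tE.
Qed.

Lemma totally_decomposable_monomial_basis (F : fieldType) (A : invAlg F) :
  (2 : F) != 0 -> totally_decomposable A -> has_monomial_basis A.
Proof.
move=> nz2 [r [Q [quatQ /monomial_basis_isomorphic]]]; apply.
elim: r quatQ => [|r IHr] quatQ.
  exact: quaternion_monomial_basis (quatQ 0%N _).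
apply: monomial_basis_tensor; last first.
  exact: quaternion_monomial_basis (quatQ r.+1 _).
by apply: IHr => i le_ir; apply/quatQ/leqW.
Qed.

(** * Weak hyperbolicity when -1 is a sum of multiples of norms by squares *)

Lemma skew_sqrt1_hyperbolic (F : fieldType) (A : invAlg F) (g : A) :
  (2 : F) != 0 -> invol g = - g -> g * g = 1 -> hyperbolic (@invol F A).
Proof.
move=> nz2 sg gg; exists (2^-1 *: (1 + g)); split.
  rewrite -scalerAl -scalerAr mulrDl mul1r mulrDr mulr1 gg (addrC g 1) -mulr2n.
  by rewrite -scaler_nat !scalerA divfK.
rewrite linearZ /= linearD /= invol1 sg; apply/eqP; rewrite eq_sym subr_eq.
rewrite -scalerDr addrACA addNr addr0 -mulr2n -scaler_nat scalerA mulVf //.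
by rewrite scale1r.
Qed.

Lemma anticommuting_sum_sqr (R : pzRingType) (n : nat) (t : nat -> R) :
  (forall l k, (l < k < n)%N -> t k * t l = - (t l * t k)) ->
  (\sum_(k < n) t k) * (\sum_(k < n) t k) = \sum_(k < n) t k * t k.
Proof.
elim: n => [|n IHn] tC; first by rewrite !big_ord0 mul0r.
rewrite !big_ord_recr /= mulrDl !mulrDr IHn => [|l k /andP[lk kn]]; last first.
  by apply: tC; rewrite lk ltnW.
rewrite addrA -(addrA _ (_ * t n)) [X in _ + X + _](_ : _ = 0) ?addr0 //.
rewrite mulr_suml mulr_sumr -big_split big1 //= => k _.
by rewrite (tC k n) ?subrr ?ltn_ord ?leqnn.
Qed.

(* The summands of g anticommute, because the matrices X k are chosen to
   correct the commutation signs and the symmetry types of the e (h k). *)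
Lemma weakly_hyperbolic_of_sum (F : fieldType) (A : invAlg F) (I : finType)
    (e : I -> A) (c : I -> F) (tau : A -> F) (w : seq (F * I)) :
  (2 : F) != 0 -> monomial_basis e c tau ->
  - 1 = \sum_(p <- w) p.1 ^+ 2 * c p.2 -> weakly_hyperbolic A.
Proof.
move=> nz2 [_ es eN eC _ _ _ _ [i1 _]] sumw.
have /fin_all_exists [sg sgE] := es.
have [cm cmE] := fin_all_exists (fun i => fin_all_exists (eC i)).
(* The default [(0, i1)] is harmless: only indices below [size w] enter the sums. *)
pose h k := (nth (0, i1) w k).2; pose f k := (nth (0, i1) w k).1.
have [N [X [Xt X1 Xc]]] := signed_permutation_matrices F (size w)
  (fun k => ~~ sg (h k)) (fun k l => ~~ cm (h k) (h l)).
exists N.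
pose t k : inv_tensor (inv_matrix F N) A :=
  tens (X k : inv_matrix F N) (e (h k)).
(* [X k] and [e (h k)] have squares 1 and [c (h k)] up to their symmetry signs, and these signs are
   opposite. *)
have tt k : (k < size w)%N -> t k * t k = - (c (h k))%:A.
  move=> kw; rewrite tensM.
  have -> : X k * X k = (-1) ^+ (~~ sg (h k)) *: 1.
    by rewrite -(X1 k kw) Xt // -scalerAl scalerA -signr_addb addbb scale1r.
  have -> : e (h k) * e (h k) = (-1) ^+ sg (h k) *: (c (h k))%:A.
    by rewrite -eN sgE -scalerAl scalerA -signr_addb addbb scale1r.
  rewrite !(tensZl, tensZr) !scalerA mulrA -signr_addb addNb addbb.
  by rewrite mulN1r scaleNr.
have tC l k : (l < k < size w)%N -> t k * t l = - (t l * t k).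
  move=> lk; rewrite !tensM Xc // cmE tensZl tensZr scalerA -signr_addb.
  by rewrite addNb addbb scaleN1r.
have st k : (k < size w)%N -> invol (t k) = - t k.
  move=> kw; rewrite [LHS]tensor_mapE /= Xt // sgE tensZl tensZr scalerA.
  by rewrite -signr_addb addNb addbb scaleN1r.
apply: (@skew_sqrt1_hyperbolic F _ (\sum_(k < size w) f k *: t k)) => //.
  rewrite linear_sum -sumrN; apply: eq_bigr => k _.
  by rewrite linearZ -scalerN; congr (_ *: _); apply: st.
rewrite (anticommuting_sum_sqr (t := fun k => f k *: t k)); last first.
  move=> l k lk.
  by rewrite -!scalerAl -!scalerAr tC // !scalerN !scalerA mulrC.
rewrite -[RHS]scale1r -[X in X *: _]opprK sumw -sumrN (big_nth (0, i1)).
rewrite big_mkord scaler_suml; apply: eq_bigr => k _.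
by rewrite -scalerAl -scalerAr tt // !(scalerN, scalerA) scaleNr expr2 ?mulrA.
Qed.

(** * Anisotropy over the extension *)

(** The opposite of each term is the sum of the others, so it is in [S] as well. *)
Lemma semiordering_sum0 (K : fieldType) (S : K -> Prop) (I : finType)
    (x : I -> K) :
  semiordering S -> (forall i, S (x i)) -> \sum_i x i = 0 -> forall i, x i = 0.
Proof.
move=> [_ _ SD _ S0] Sx sum0 i; apply/S0; split=> //.
have -> : - x i = \sum_(j | j != i) x j.
  by move: sum0; rewrite (bigD1 i) //= => /eqP; rewrite addrC addr_eq0 => /eqP.
by elim/big_ind: _ => //; have [] := (S0 0).2 erefl.
Qed.

Lemma monomial_basis_anisotropic (F K : fieldType) (iota : {rmorphism F -> K})
    (A : invAlg F) (I : finType) (e : I -> A) (c : I -> F) (tau : A -> F)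
    (S : K -> Prop) :
  monomial_basis e c tau -> semiordering S -> (forall i, S (iota (c i))) ->
  ~ weakly_isotropic (tensor_map (@invol F A) (@idfun (ext_alg iota))).
Proof.
move=> [eS _ _ _ tL tE c0 _ _] semiS Sc [n [x [x0 sum0]]].
have [S1 SM _ _ _] := semiS.
(* [g] extends [tau] linearly to the algebra over [K]. *)
have [||g [gL gE _]] :=
  @tensor_universal F A (ext_alg iota) (ext_alg iota) (fun a b => tau a *: b).
- by move=> b k u v; rewrite tL scalerDl scalerA.
- by move=> a k u v; rewrite scalerDr !scalerA mulrC.
pose gl := GRing.isLinear.Build F _ _ *:%R g gL.
pose G : {linear tensor A (ext_alg iota) -> ext_alg iota} := HB.pack g gl.
have gD : {morph g : u v / u + v} := linearD G.
have g0 : g 0 = 0 := linear0 G.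
pose s := tensor_map (@invol F A) (@idfun (ext_alg iota)).
have sL : linear s := tensor_map_is_linear (@invol F A) (@idfun (ext_alg iota)).
have sD : {morph s : u v / u + v}.
  by move=> u v; have := sL 1 u v; rewrite !scale1r.
have s0 : s 0 = 0 by apply: (addrI (s 0)); rewrite -sD !addr0.
have /fin_all_exists [y xE] : forall m, exists y : I -> ext_alg iota,
    x m = \sum_i tens (e i) (y i).
  by move=> m; apply: tens_lincomb.
rewrite -/s in sum0.
have gsx m : g (s (x m) * x m) =
    \sum_i (y m i) ^+ 2 * iota (c i).
  rewrite xE (big_morph s sD s0) mulr_suml.
  rewrite (big_morph g gD g0); apply: eq_bigr => i _.
  rewrite mulr_sumr (big_morph g gD g0) (bigD1 i) //= big1 => [|j ji].
    rewrite addr0 /s tensor_mapE tensM gE tE eqxx; exact: mulrC.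
  by rewrite /s tensor_mapE tensM gE tE eq_sym (negPf ji) scale0r.
have := congr1 g sum0; rewrite (big_morph g gD g0) g0.
under eq_bigr do rewrite gsx.
rewrite (pair_bigA _ (fun m i => y m i ^+ 2 * iota (c i))) /= => sumy0.
(* All terms of the double sum are in [S], so each one vanishes. Already for the index [ord0] this
   contradicts [x0]. *)
have y0 := semiordering_sum0 semiS _ sumy0.
case/eqP: (x0 ord0); rewrite xE big1 // => i _.
have /eqP := y0 (fun p => SM _ _ (Sc p.2)) (ord0, i).
rewrite mulf_eq0 expf_eq0 fmorph_eq0 (negPf (c0 i)) orbF /= => /eqP->.
exact: tens0r.
Qed.

Theorem theorem1p3 (F K : fieldType) (iota : {rmorphism F -> K})
    (A : invAlg F) :
  formally_real F ->
  totally_positive iota ->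
  central_simple A ->
  orthogonal_inv A ->
  totally_decomposable A ->
  weakly_isotropic (tensor_map (@invol F A) (@idfun (ext_alg iota))) ->
  weakly_hyperbolic A.
Proof.
move=> realF posK _ _ decA isoK.
have nz2 : (2 : F) != 0.
  (* In characteristic 2, -1 is the square of 1. *)
  apply/eqP => two0; apply: realF; exists [:: 1]; rewrite big_seq1 expr1n.
  by apply/eqP; rewrite eq_sym -addr_eq0 -two0.
have [I [e [c [tau basis]]]] := totally_decomposable_monomial_basis nz2 decA.
pose T x := exists w : seq (F * I), x = \sum_(p <- w) p.1 ^+ 2 * c p.2.
have [[w sumw]|TN1] := pselect (T (- 1)).
  exact: weakly_hyperbolic_of_sum nz2 basis sumw.
have [_ _ _ _ _ _ _ cM [i1 c1]] := basis.
have preT : proper_preordering T.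
  split=> // [a|_ _ [w ->] [w' ->]|_ _ [w ->] [w' ->]].
  - by exists [:: (a, i1)]; rewrite big_seq1 c1 mulr1.
  - by exists (w ++ w'); rewrite big_cat.
  - have [f fE] := fin_all_exists (fun i => fin_all_exists (cM i)).
    have [k kE] := fin_all_exists (fun i => fin_all_exists (fE i)).
    (* Products are expanded termwise; [c i * c j] is the square of [f i j] times [c (k i j)]. *)
    exists [seq (p.1 * q.1 * f p.2 q.2, k p.2 q.2) | p <- w, q <- w'].
    rewrite big_allpairs_dep mulr_suml /=; apply: eq_bigr => p _.
    rewrite mulr_sumr; apply: eq_bigr => q _.
    by rewrite mulrACA kE !exprMn mulrA.
have [P semiP TP] := proper_preordering_sub_semiordering preT.
have [S semiS SP] := posK P semiP.
case: (monomial_basis_anisotropic basis semiS _ isoK) => i.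
by apply/SP/TP; exists [:: (1, i)]; rewrite big_seq1 expr1n mul1r.
Qed.
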